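(* Let $q\ge 3$ and $0\le a\le d-1$. Then (notation as in the context): (a) $|\lambda_1^a|=\max\{|\lambda_r^a|:r=1,\dots,d\}$ if $\epsilon\ge1$; (b) $|\lambda_d^a|=\max\{|\lambda_r^a|:r=1,\dots,d\}$ if $\epsilon\le 1$; (c) $\lambda_1^a=\min\{\lambda_r^a:r=1,\dots,d\}$ if $d-a$ is even or $\epsilon\ge1$; (d) $\lambda_d^a=\min\{\lambda_r^a:r=1,\dots,d\}$ if $d-a$ is odd and $\epsilon\le1$.
   Context: For a finite classical polar space of rank $d$, order $q$ and type $\epsilon$ ($\epsilon=0,\frac12,1,1,\frac32,2$ for $Q^+(2d-1,q)$, $H(2d-1,q)$, $Q(2d,q)$, $W(2d-1,q)$, $H(2d,q)$, $Q^-(2d+1,q)$), $A_i$ is the adjacency matrix on generators with $(A_i)_{xy}=1$ iff $d-\dim(x\cap y)=i$; they have common eigenspaces $V_0,\dots,V_d$ on which $A_s$ acts as $P_{r,s}=\sum_{t=\max(r-s,0)}^{\min(d-s,r)}(-1)^{r-t}\genfrac{[}{]}{0pt}{}{d-r}{d-s-t}_q\genfrac{[}{]}{0pt}{}{r}{t}_q q^{\binom{r-t}{2}+\binom{s-r+t}{2}+(s-r+t)\epsilon}$. Define $\lambda_r^a=\sum_{s=0}^aP_{r,d-s}$, the eigenvalue of $\sum_{s=0}^aA_{d-s}$ on $V_r$. Gaussian coefficient $\genfrac{[}{]}{0pt}{}{n}{k}_q=\prod_{i=1}^k\frac{q^{n-i+1}-1}{q^i-1}$ for $0\le k\le n$,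 $0$ otherwise. *)

(* Defs.v *)
From HB Require Import structures.
From mathcomp Require Import all_boot all_order all_algebra.
From mathcomp Require Import mathcomp_extra boolp classical_sets reals exp.

Set Implicit Arguments.
Unset Strict Implicit.
Unset Printing Implicit Defensive.

Import Order.TTheory GRing.Theory Num.Theory.

Local Open Scope classical_set_scope.
Local Open Scope ring_scope.

(* The six families of finite classical polar spaces of rank d. *)
Inductive polar_family : Set :=
| Qplus    (* Q^+(2d-1, q) *)
| Hodd     (* H(2d-1, q) *)
| Qpar     (* Q(2d, q) *)
| Wsymp    (* W(2d-1, q) *)
| Heven    (* H(2d, q) *)
| Qminus.  (* Q^-(2d+1, q) *)

Definition prime_power (q : nat) : Prop :=
  exists p k : nat, [/\ prime p, (0 < k)%N & q = (p ^ k)%N].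

Definition hermitian (X : polar_family) : bool :=
  match X with Hodd | Heven => true | _ => false end.

(* q is the order of the defining field; a Hermitian form needs that field to
   be quadratic over a subfield, hence q to be a square.  For every rank
   d >= 1 these conditions are exactly the ones under which the polar space
   of family X, rank d and order q exists. *)
Definition polar_order (X : polar_family) (q : nat) : Prop :=
  prime_power q /\ (hermitian X -> exists m : nat, q = (m ^ 2)%N).

Section PolarEigenvalues.
Variable R : realType.

Definition polar_type (X : polar_family) : R :=
  match X with
  | Qplus => 0
  | Hodd => 1 / 2
  | Qpar => 1
  | Wsymp => 1
  | Heven => 3 / 2
  | Qminus => 2
  end.

Definition gauss_binom (q n k : nat) : R :=
  if (k <= n)%N then
    \prod_(1 <= i < k.+1) ((q%:R ^+ (n - i + 1) - 1) / (q%:R ^+ i - 1))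
  else 0.

(* P_{r,s} for 0 <= r, s <= d.  On nat, [r - s] is max(r - s, 0); in the range
   of summation no other subtraction is truncated, once s - r + t is written
   s + t - r. *)
Definition polar_P (d q : nat) (e : R) (r s : nat) : R :=
  \sum_(r - s <= t < (minn (d - s) r).+1)
    (-1) ^+ (r - t) * gauss_binom q (d - r) (d - s - t) * gauss_binom q r t *
    q%:R `^ ('C(r - t, 2)%:R + 'C(s + t - r, 2)%:R + (s + t - r)%:R * e).

Definition polar_lambda (d q : nat) (e : R) (a r : nat) : R :=
  \sum_(0 <= s < a.+1) polar_P d q e r (d - s).

Definition is_max (A : set R) (x : R) : Prop := A x /\ ubound A x.
Definition is_min (A : set R) (x : R) : Prop := A x /\ lbound A x.

End PolarEigenvalues.

(* Main.v *)
Require Import Defs.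
From HB Require Import structures.
From mathcomp Require Import all_boot all_order all_algebra.
From mathcomp Require Import zify ring lra.
From mathcomp Require Import mathcomp_extra boolp classical_sets reals exp.

(** By the q-binomial theorem, P_{r,d-s} is the coefficient of X^s in
    prod_{i<r} (X - q^i) * prod_{j<d-r} (X + q^(e+j)).  For r >= 1 the factor
    X - 1 turns partial sums into single coefficients, so lambda_r^a is minus
    the coefficient of X^a in
    prod_{1<=i<r} (X - q^i) * prod_{j<d-r} (X + q^(e+j)).
    For r = 1 and r = d all roots have the same sign, hence no cancellation
    occurs, and the claims follow by comparing the absolute values of the d - 1
    roots factor by factor; in (c), lambda_1 <= lambda_d for e < 1 and d - a even
    holds because the two have opposite signs. *)

Import Order.TTheory GRing.Theory Num.Theory.

Local Open Scope classical_set_scope.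
Local Open Scope ring_scope.

Section GaussBinomial.
Variables (R : realType) (q : nat).
Hypothesis q_gt1 : (1 < q)%N.
Implicit Types n t i : nat.

Let b : R := q%:R.

Lemma expr_order_neq0 i : b ^+ i.+1 - 1 != 0.
Proof. by rewrite subr_eq0 gt_eqF// exprn_egt1// /b ltr1n. Qed.

Lemma gauss_binom0 n : gauss_binom R q n 0 = 1.
Proof. by rewrite /gauss_binom leq0n big_geq. Qed.

Lemma gauss_binom_small n t : (n < t)%N -> gauss_binom R q n t = 0.
Proof. by rewrite /gauss_binom ltnNge => /negbTE ->. Qed.

Lemma gauss_binomSr n t : (t <= n)%N ->
  gauss_binom R q n t.+1 * (b ^+ t.+1 - 1) =
  gauss_binom R q n t * (b ^+ (n - t) - 1).
Proof.
move=> le_tn; rewrite /gauss_binom le_tn.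
case: (ltnP t n) => [lt_tn|le_nt].
  rewrite big_nat_recr//= -mulrA divfK ?expr_order_neq0//.
  by rewrite addn1 subnSK.
have -> : (n - t = 0)%N by apply/eqP; rewrite subn_eq0.
by rewrite expr0 subrr mul0r mulr0.
Qed.

Lemma gauss_binomSS n t : (t <= n)%N ->
  gauss_binom R q n.+1 t.+1 * (b ^+ t.+1 - 1) =
  gauss_binom R q n t * (b ^+ n.+1 - 1).
Proof.
elim: t => [|t IHt] le_tn; first by rewrite gauss_binomSr// !gauss_binom0 subn0.
apply: (mulIf (expr_order_neq0 t)); rewrite gauss_binomSr ?ltnS 1?ltnW//.
rewrite subSS mulrAC IHt 1?ltnW// [RHS]mulrAC gauss_binomSr 1?ltnW//.
by rewrite mulrAC.
Qed.

(** The q-Pascal rule: clear the denominator [b ^+ t.+1 - 1] and split q^(n+1) - 1 as (q^(t+1) - 1)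
    + q^(t+1) (q^(n-t) - 1). *)
Lemma gauss_binomS n t :
  gauss_binom R q n.+1 t.+1 =
  gauss_binom R q n t + b ^+ t.+1 * gauss_binom R q n t.+1.
Proof.
case: (leqP t n) => [le_tn|lt_nt]; last first.
  by rewrite !gauss_binom_small ?mulr0 ?addr0// ltnW.
apply: (mulIf (expr_order_neq0 t)).
rewrite gauss_binomSS// mulrDl -mulrA gauss_binomSr//.
have -> : b ^+ n.+1 = b ^+ t.+1 * b ^+ (n - t) by rewrite -exprD addSn subnKC.
by ring.
Qed.

(** The q-binomial theorem, by induction through the q-Pascal rule. The free [y] serves the
    progressions starting at -1, q^e, -q and q alike. *)
Lemma coef_prod_geometric (y : R) n t :
  (\prod_(i < n) ('X + (y * b ^+ i)%:P))`_t =
  gauss_binom R q n t * b ^+ 'C(n - t, 2) * y ^+ (n - t).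
Proof.
elim: n t => [|n IHn] [|t]; first by rewrite big_ord0 coef1 gauss_binom0 !mul1r.
- by rewrite big_ord0 coef1 gauss_binom_small// !mul0r.
- rewrite big_ord_recr /= mulrDr coefD coefMX coefMC add0r IHn !subn0.
  by rewrite !gauss_binom0 binS bin1 exprD exprS; ring.
rewrite big_ord_recr /= mulrDr coefD coefMX coefMC /= !IHn subSS gauss_binomS.
case: (ltnP t n) => [lt_tn|le_nt]; last first.
  by rewrite (@gauss_binom_small n t.+1)// !(mul0r, mulr0) !addr0.
rewrite -(subnSK lt_tn) binS bin1 exprD exprS.
have -> : b ^+ n = b ^+ t.+1 * b ^+ (n - t.+1) by rewrite -exprD subnKC.
by ring.
Qed.

End GaussBinomial.

Section Domination.
Variable R : realDomainType.
Implicit Types p P : {poly R}.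

(** Coefficientwise majorization; it forces the coefficients of [P] to be nonnegative, which makes
    it stable under products. *)
Definition coef_dom p P := forall k, `|p`_k| <= P`_k.

Lemma coef_domM p1 P1 p2 P2 :
  coef_dom p1 P1 -> coef_dom p2 P2 -> coef_dom (p1 * p2) (P1 * P2).
Proof.
move=> dom1 dom2 k; rewrite !coefM (le_trans (ler_norm_sum _ _ _))//.
by apply: ler_sum => i _; rewrite normrM ler_pM.
Qed.

Lemma coef_dom_prod n (u v : nat -> R) :
  (forall i, (i < n)%N -> `|u i| <= v i) ->
  coef_dom (\prod_(i < n) ('X + (u i)%:P)) (\prod_(i < n) ('X + (v i)%:P)).
Proof.
elim: n => [|n IHn] le_uv; first by move=> k; rewrite !big_ord0 coef1 normr_nat.
rewrite !big_ord_recr /=; apply: coef_domM.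
  by apply: IHn => i /ltnW; exact: le_uv.
move=> k; rewrite !coefD !coefX !coefC; case: k => [|k] /=.
  by rewrite !add0r le_uv.
by rewrite !addr0 normr_nat.
Qed.

End Domination.

Section Eigenvalues.
Variables (R : realType) (q : nat).
Hypothesis q_gt1 : (1 < q)%N.

Let b : R := q%:R.

(** The summation index [t] of [polar_P] is the degree taken from the first product in the Cauchy
    formula. *)
Lemma polar_P_coef d (e : R) r s : (r <= d)%N -> (s <= d)%N ->
  polar_P d q e r (d - s) =
  (\prod_(i < r) ('X + (-1 * b ^+ i)%:P) *
   \prod_(i < d - r) ('X + (b `^ e * b ^+ i)%:P))`_s.
Proof.
move=> le_rd le_sd; rewrite coefM /polar_P subKn//.
have b_ge0 : 0 <= b by rewrite /b ler0n.
have b_neq0 : b != 0 by rewrite /b pnatr_eq0 -lt0n ltnW.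
rewrite (big_nat_widenl _ 0)// (big_nat_widen _ _ s.+1) ?ltnS ?geq_minl//.
rewrite big_mkord big_mkcond; apply: eq_bigr => -[t lt_ts] _ /=.
rewrite !coef_prod_geometric// -[(q%:R)]/b.
case: ifPn => [/andP[le_t]|].
  rewrite ltnS leq_min => /andP[le_ts le_tr].
  have -> : (d - s + t - r = d - r - (s - t))%N by lia.
  rewrite !powRD ?b_neq0 ?implybT// [_%:R * e]mulrC powRrM !powR_mulrn ?powR_ge0//.
  by ring.
(* The added indices contribute nothing: the first case means s - t > d - r, so either way a
   Gaussian coefficient vanishes. *)
move=> t_out; have /orP[lt_t|lt_rt] : (t < r - (d - s))%N || (r < t)%N by lia.
  by rewrite [gauss_binom _ _ (d - r) _]gauss_binom_small ?mul0r ?mulr0//; lia.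
by rewrite [gauss_binom _ _ r _]gauss_binom_small ?mul0r//.
Qed.

(** Telescoping: the coefficient of X^s in (X - 1) p is p_(s-1) - p_s. *)
Lemma sum_coef_mulXsub1 (p : {poly R}) a :
  \sum_(0 <= s < a.+1) (('X - 1) * p)`_s = - p`_a.
Proof.
elim: a => [|a IHa].
  by rewrite big_nat1 mulrBl mul1r coefB coefXM sub0r.
by rewrite big_nat_recr// IHa mulrBl mul1r coefB coefXM /= addKr.
Qed.

Lemma polar_lambda_coef d (e : R) a r : (r < d)%N -> (a < d)%N ->
  polar_lambda d q e a r.+1 =
  - (\prod_(i < r) ('X + (- b * b ^+ i)%:P) *
     \prod_(i < d - r.+1) ('X + (b `^ e * b ^+ i)%:P))`_a.
Proof.
move=> lt_rd lt_ad; rewrite -sum_coef_mulXsub1 /polar_lambda.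
apply: eq_big_nat => s /andP[_ lt_sa].
rewrite polar_P_coef ?(leq_trans lt_sa)// 1?ltnW// ?(leq_ltn_trans _ lt_ad)//.
(* The factor for i = 0 is X - 1; the others form a progression starting at -q. *)
rewrite big_ord_recl /= expr0 mulr1 polyCN -mulrA.
under eq_bigr => i _.
  rewrite /bump add1n exprS mulNr mul1r -mulNr; over.
by [].
Qed.

(** The d - r factors with constants q^(e+i) are common to both sides; each other root q^(1+i) is
    matched with q^(e+d-r+i), which is at least as large when q <= q^(e+d-r). Bounding by
    [- polar_lambda d q e a 1] rather than its absolute value also yields the minimum. *)
Lemma polar_lambda_dom1 d (e : R) a r : (a < d)%N -> (1 <= r <= d)%N ->
  0 <= e -> (r < d)%N || (1 <= e) ->
  `|polar_lambda d q e a r| <= - polar_lambda d q e a 1.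
Proof.
case: r => // r lt_ad /= lt_rd e_ge0 r_or_e.
have b_gt1 : 1 < b by rewrite /b ltr1n.
have b_ge1 := ltW b_gt1.
have b_ge0 : 0 <= b := le_trans ler01 b_ge1.
rewrite (polar_lambda_coef _ _ _ _ lt_rd)// (@polar_lambda_coef _ _ _ 0%N); try lia.
rewrite opprK normrN.
rewrite big_ord0 mul1r subn1.
have -> : d.-1 = (d - r.+1 + r)%N by lia.
rewrite big_split_ord /= mulrC.
apply: coef_domM.
  apply: (@coef_dom_prod _ _ (fun i => b `^ e * b ^+ i)
                             (fun i => b `^ e * b ^+ i)) => i _.
  by rewrite ger0_norm// mulr_ge0 ?powR_ge0// exprn_ge0.
apply: (@coef_dom_prod _ _ (fun i => - b * b ^+ i)
                           (fun i => b `^ e * b ^+ (d - r.+1 + i))) => i _.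
rewrite mulNr normrN ger0_norm ?mulr_ge0 ?exprn_ge0// exprD mulrA.
rewrite ler_wpM2r ?exprn_ge0//.
case/orP: r_or_e => [lt_Srd|e_ge1].
  rewrite -[leLHS]mul1r ler_pM//.
    by rewrite -[leLHS](powRr0 b) ler_powR.
  by rewrite -[leLHS]expr1 ler_weXn2l// subn_gt0.
rewrite -[leLHS]mulr1 ler_pM ?exprn_ege1//.
by rewrite -[leLHS](powRr1 b_ge0) ler_powR.
Qed.

(** The right side is the absolute value of [polar_lambda d q e a d]: all d - 1 roots are positive
    there, so the coefficient of X^a has sign (-1)^(d-1-a). Constants q^(e+i) are matched with
    q^(r+i), using e <= 1 and r >= 1. *)
Lemma polar_lambda_domd d (e : R) a r : (a < d)%N -> (1 <= r <= d)%N ->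
  e <= 1 ->
  `|polar_lambda d q e a r| <= - (-1) ^+ (d.-1 - a) * polar_lambda d q e a d.
Proof.
case: d => // d lt_ad; case: r => //= r lt_rd e_le1.
have b_gt1 : 1 < b by rewrite /b ltr1n.
have b_ge1 := ltW b_gt1.
have b_ge0 : 0 <= b := le_trans ler01 b_ge1.
rewrite !polar_lambda_coef// normrN subSS subnn big_ord0 mulr1 mulrNN.
have -> : (-1) ^+ (d - a) * (\prod_(i < d) ('X + (- b * b ^+ i)%:P))`_a =
          (\prod_(i < d) ('X + (b * b ^+ i)%:P))`_a.
  by rewrite !coef_prod_geometric// [(- b) ^+ _]exprNn mulrCA signrMK.
have -> : \prod_(i < d) ('X + (b * b ^+ i)%:P) =
  \prod_(i < r) ('X + (b * b ^+ i)%:P) *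
  \prod_(i < d - r) ('X + (b * b ^+ (r + i))%:P).
  have d_eq : d = (r + (d - r))%N by rewrite subnKC.
  by rewrite [in LHS]d_eq big_split_ord.
apply: coef_domM.
  apply: (@coef_dom_prod _ _ (fun i => - b * b ^+ i) (fun i => b * b ^+ i)).
  by move=> i _; rewrite mulNr normrN ger0_norm// mulr_ge0// exprn_ge0.
apply: (@coef_dom_prod _ _ (fun i => b `^ e * b ^+ i)
                           (fun i => b * b ^+ (r + i))) => i _.
rewrite ger0_norm ?mulr_ge0 ?powR_ge0 ?exprn_ge0//.
rewrite ler_pM ?powR_ge0 ?exprn_ge0//.
  by rewrite -[leRHS](powRr1 b_ge0) ler_powR.
by rewrite ler_weXn2l// leq_addl.
Qed.

End Eigenvalues.

Theorem theorem8p2 (R : realType) (X : polar_family) (d q a : nat)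
    (hX : polar_order X q) (hq : (3 <= q)%N) (ha : (a < d)%N) :
  let e : R := polar_type R X in
  let lambda : nat -> R := polar_lambda d q e a in
  let I : set nat := [set r | (1 <= r <= d)%N] in
  [/\ 1 <= e -> is_max [set `|lambda r| | r in I] `|lambda 1%N|,
      e <= 1 -> is_max [set `|lambda r| | r in I] `|lambda d|,
      ~~ odd (d - a) \/ 1 <= e -> is_min [set lambda r | r in I] (lambda 1%N) &
      odd (d - a) /\ e <= 1 -> is_min [set lambda r | r in I] (lambda d)].
Proof.
move=> e lambda I.
have q_gt1 : (1 < q)%N by exact: ltnW.
have d_gt0 : (0 < d)%N by exact: leq_ltn_trans ha.
have I1 : I 1%N by rewrite /I /= d_gt0.
have Id : I d by rewrite /I /= d_gt0 leqnn.
have e_ge0 : 0 <= e by rewrite /e; case: (X) => /=; lra.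
have dom1 r : I r -> (r < d)%N || (1 <= e) -> `|lambda r| <= - lambda 1%N.
  by move=> Ir; exact: polar_lambda_dom1.
have domd r : I r -> e <= 1 ->
    `|lambda r| <= - (-1) ^+ (d.-1 - a) * lambda d.
  by move=> Ir; exact: polar_lambda_domd.
have odd_da : odd (d.-1 - a) = ~~ odd (d - a).
  by rewrite -subn1 subnAC subn1 -[in RHS](@prednK (d - a)) ?subn_gt0//= negbK.
split.
- move=> e_ge1; split; first by exists 1%N.
  move=> _ [r Ir <-]; apply: le_trans (dom1 r Ir _) _; first by rewrite e_ge1 orbT.
  by rewrite -normrN ler_norm.
- move=> e_le1; split; first by exists d.
  move=> _ [r Ir <-]; apply: le_trans (domd r Ir e_le1) _.
  by apply: le_trans (ler_norm _) _; rewrite normrM normrN normr_sign mul1r.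
- move=> da_or_e; split; first by exists 1%N.
  move=> _ [r Ir <-].
  (* [dom1] misses only r = d with e < 1. There d - a is even, so [domd] at d gives [lambda d] >= 0,
     while [dom1] at 1 gives [lambda 1] <= 0 once d > 1. *)
  have [r_or_e|] := boolP ((r < d)%N || (1 <= e)).
    by have := dom1 r Ir r_or_e; rewrite ler_norml opprK => /andP[].
  rewrite negb_or -leqNgt -ltNge => /andP[le_dr e_lt1].
  have -> : r = d by case/andP: Ir => _ le_rd; apply/eqP; rewrite eqn_leq le_rd.
  case: da_or_e => [even_da|]; last by rewrite leNgt e_lt1.
  have [lt_1d|le_d1] := ltnP 1 d; last by have -> : d = 1%N by lia.
  have := le_trans (normr_ge0 _) (domd d Id (ltW e_lt1)).
  rewrite -signr_odd odd_da even_da expr1 opprK mul1r => /(le_trans _); apply.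
  by rewrite -oppr_ge0 (le_trans (normr_ge0 _) (dom1 _ I1 _)) ?lt_1d.
- move=> [odd_d e_le1]; split; first by exists d.
  move=> _ [r Ir <-].
  (* For d - a odd the sign is +1, so the bound is [- lambda d] itself. *)
  have := domd r Ir e_le1; rewrite -signr_odd odd_da odd_d expr0 mulN1r.
  by rewrite ler_norml opprK => /andP[].
Qed.
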